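(* Let $\mathfrak n=(\mathfrak v\oplus_{\perp}\mathfrak z,[\cdot,\cdot],\langle\cdot,\cdot\rangle_{\mathfrak n}=\langle\cdot,\cdot\rangle_{\mathfrak v}+\langle\cdot,\cdot\rangle_{\mathfrak z})$ be a finite-dimensional real $2$-step nilpotent Lie algebra with center $\mathfrak z$, endowed with a scalar product $\langle\cdot,\cdot\rangle_{\mathfrak n}$ whose restriction $\langle\cdot,\cdot\rangle_{\mathfrak z}$ to $\mathfrak z$ is non-degenerate, with $\mathfrak v=\mathfrak z^{\perp}$. Then $\mathfrak n$ is a pseudo $H$-type Lie algebra if and only if $\mathfrak n$ is of general $H$-type.
   Context: A scalar product is a non-degenerate (possibly indefinite) symmetric bilinear form. Pseudo $H$-type: define $J:\mathfrak z\to\mathrm{End}(\mathfrak v)$ by $\langle J_Zv,w\rangle_{\mathfrak v}=\langle Z,[v,w]\rangle_{\mathfrak z}$ for all $v,w\in\mathfrak v$, $Z\in\mathfrak z$. The algebra $\mathfrak n$ is a pseudo $H$-type Lie algebra if $\langle J_Zv,J_Zv\rangle_{\mathfrak v}=\langle Z,Z\rangle_{\mathfrak z}\langle v,v\rangle_{\mathfrak v}$ for all $Z\in\mathfrak z$, $v\in\mathfrak v$. General $H$-type: for $v\in\mathfrak v$ let $\mathrm{ad}_v:\mathfrak v\to\mathfrak z$, $\mathrm{ad}_vw=[v,w]$. The algebra $\mathfrak n$ is of general $H$-type if for every $v\in\mathfrak v$ with $\langle v,v\rangle_{\mathfrak v}=\pm1$ the restriction of $\langle\cdot,\cdot\rangle_{\mathfrak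 v}$ to $\ker(\mathrm{ad}_v)$ is non-degenerate and, with $\mathfrak V_v$ the orthogonal complement of $\ker(\mathrm{ad}_v)$ in $\mathfrak v$, the map $\mathrm{ad}_v:\mathfrak V_v\to\mathfrak z$ is a surjective isometry if $\langle v,v\rangle_{\mathfrak v}=1$ and a surjective anti-isometry (i.e. $\langle\mathrm{ad}_vx,\mathrm{ad}_vy\rangle_{\mathfrak z}=-\langle x,y\rangle_{\mathfrak v}$) if $\langle v,v\rangle_{\mathfrak v}=-1$. *)

(* Defs.v *)
From HB Require Import structures.
From mathcomp Require Import all_boot all_order all_algebra.
From mathcomp Require Import reals.

Set Implicit Arguments.
Unset Strict Implicit.
Unset Printing Implicit Defensive.

Import GRing.Theory.
Local Open Scope ring_scope.

Section RestrictedForm.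
Context (F : fieldType) (V : vectType F) (B : {symmetric V}) (U : {vspace V}).

Definition restr_form (x y : subvs_of U) : F := B (vsval x) (vsval y).

Lemma restr_form_bilinear :
  bilinear_for (GRing.Scale.Law.clone _ _ *%R _)
    (GRing.Scale.Law.clone _ _ (idfun \; *%R) _) restr_form.
Proof.
split=> [u'|u] a x y; rewrite /restr_form !linearP /=.
- by rewrite linearPl.
- by [].
Qed.

HB.instance Definition _ :=
  bilinear_isBilinear.Build F _ _ _ _ _ restr_form restr_form_bilinear.

Lemma restr_form_hermitian x y :
  restr_form x y = (-1) ^+ false * idfun (restr_form y x).
Proof. exact: hermitian_subproof. Qed.

HB.instance Definition _ :=
  isHermitianSesquilinear.Build F _ false idfun restr_form restr_form_hermitian.

Lemma restr_form_nondegenerate :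
  nondegenerate restr_form = (U :&: orthov B U == 0)%VS.
Proof.
apply/eqP/eqP => H; apply/eqP; rewrite -subv0; apply/subvP => x.
- case/memv_capP => xU /mem_orthovP xo; rewrite memv0.
  have : vsproj U x \in orthov restr_form fullv.
    apply/mem_orthovP => y _; rewrite /= /restr_form vsprojK //.
    exact/xo/subvsP.
  by rewrite H memv0 => /eqP E; rewrite -(vsprojK xU) E linear0.
- move=> /mem_orthovP xo; rewrite memv0 -(inj_eq val_inj) -memv0 -H.
  rewrite memv_cap subvsP /=; apply/mem_orthovP => y yU.
  by have := xo (vsproj U y) (memvf _); rewrite /= /restr_form vsprojK.
Qed.

End RestrictedForm.
Arguments restr_form {F V} B U x y.

Section LieAlgebra.
Context (F : fieldType) (n : vectType F) (br : {bilinear n -> n -> n}).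

Definition is_lie_bracket : Prop :=
  (forall x, br x x = 0) /\
  (forall x y z, br x (br y z) + br y (br z x) + br z (br x y) = 0).

(* [n, [n, n]] = 0 and [n, n] <> 0: nilpotent of step exactly two. *)
Definition two_step_nilpotent : Prop :=
  (forall x y z, br x (br y z) = 0) /\ (exists x y, br x y != 0).

Definition ad (x : n) : 'End(n) := linfun (br x).

Fact ad_is_linear : linear ad.
Proof.
by move=> a x y; apply/lfunP => z; rewrite add_lfunE scale_lfunE !lfunE /= linearPl.
Qed.

HB.instance Definition _ := GRing.isLinear.Build F n 'End(n) _ ad ad_is_linear.

Definition center : {vspace n} := lker (linfun ad).

Lemma centerP x : reflect (forall y, br x y = 0) (x \in center).
Proof.
rewrite memv_ker lfunE /=; apply: (iffP eqP) => [/lfunP H y|H].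
  by have := H y; rewrite lfunE lfunE.
by apply/lfunP => y; rewrite lfunE /= H zero_lfunE.
Qed.

End LieAlgebra.

Section HType.
Context (F : fieldType) (v z : vectType F) (br : {bilinear v -> v -> z}).
Context (Bv : {symmetric v}) (Bz : {symmetric z}).

(* F^o, rather than F, carries the vector space structure of F over itself. *)
Definition pairing (x : v) : 'Hom(v, F^o) := linfun (Bv x : v -> F^o).

Fact pairing_is_linear : linear pairing.
Proof.
by move=> a x y; apply/lfunP => w; rewrite add_lfunE scale_lfunE !lfunE /= linearPl.
Qed.

HB.instance Definition _ :=
  GRing.isLinear.Build F v 'Hom(v, F^o) _ pairing pairing_is_linear.

Definition flat : 'Hom(v, 'Hom(v, F^o)) := linfun pairing.

Lemma flatE x y : flat x y = Bv x y.
Proof. by rewrite lfunE /= lfunE. Qed.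

Lemma flat_surj : nondegenerate Bv -> limg flat = fullv.
Proof.
move=> /eqP nd; apply/eqP; rewrite -(dimv_leqif_eq (subvf _)).
have ker0 : (fullv :&: lker flat = 0)%VS.
  apply/eqP; rewrite -subv0 -nd; apply/subvP => x /memv_capP[_].
  rewrite memv_ker => /eqP fx0; apply/mem_orthovP => y _.
  by rewrite -flatE fx0 zero_lfunE.
by rewrite (limg_dim_eq ker0) !dimvf /dim /= muln1.
Qed.

Definition Jfun (Z : z) (x : v) : v :=
  (flat^-1)%VF (linfun ((fun w => Bz Z (br x w)) : v -> F^o)).

Fact Jfun_functional_linear Z x :
  linear ((fun w => Bz Z (br x w)) : v -> F^o).
Proof. by move=> a s t; rewrite linearPr linearDr linearZr_LR. Qed.

Fact Jfun_is_linear Z : linear (Jfun Z).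
Proof.
move=> a x y; rewrite /Jfun -linearP; congr ((flat^-1)%VF _).
pose L u : {linear v -> F^o} := HB.pack ((fun w => Bz Z (br u w)) : v -> F^o)
  (GRing.isLinear.Build F v F^o _ _ (Jfun_functional_linear Z u)).
have E u w : linfun ((fun w => Bz Z (br u w)) : v -> F^o) w = Bz Z (br u w).
  exact: (lfunE (L u)).
apply/lfunP => w; rewrite add_lfunE scale_lfunE !E linearPl.
by rewrite linearDr linearZr_LR.
Qed.

HB.instance Definition _ Z :=
  GRing.isLinear.Build F v v _ (Jfun Z) (Jfun_is_linear Z).

(* For a non-degenerate <.,.>_v, this is the operator J_Z determined by
   <J_Z x, w>_v = <Z, [x, w]>_z: see JmapE and Jmap_unique. *)
Definition Jmap (Z : z) : 'End(v) := linfun (Jfun Z).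

Lemma JmapE : nondegenerate Bv ->
  forall Z x w, Bv (Jmap Z x) w = Bz Z (br x w).
Proof.
move=> nd Z x w; rewrite -flatE [Jmap Z x]lfunE /= /Jfun limg_lfunVK ?flat_surj ?memvf //.
pose L : {linear v -> F^o} := HB.pack ((fun w => Bz Z (br x w)) : v -> F^o)
  (GRing.isLinear.Build F v F^o _ _ (Jfun_functional_linear Z x)).
exact: (lfunE L).
Qed.

Lemma Jmap_unique : nondegenerate Bv -> forall (J : z -> v -> v),
  (forall Z x w, Bv (J Z x) w = Bz Z (br x w)) ->
  forall Z x, J Z x = Jmap Z x.
Proof.
move=> nd J JE Z x; apply/eqP; rewrite -subr_eq0 -memv0 -(eqP nd).
by apply/mem_orthovP => w _; rewrite linearBl /= JE JmapE ?subrr.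
Qed.

Definition pseudo_H_type : Prop :=
  forall (Z : z) (x : v), Bv (Jmap Z x) (Jmap Z x) = Bz Z Z * Bv x x.

Definition adv (x : v) : 'Hom(v, z) := linfun (br x).

Definition adv_perp (x : v) : {vspace v} := orthov Bv (lker (adv x)).

Definition general_H_type : Prop :=
  forall x : v, Bv x x = 1 \/ Bv x x = - 1 ->
  [/\ nondegenerate (restr_form Bv (lker (adv x))),
      (adv x @: adv_perp x = fullv)%VS,
      Bv x x = 1 ->
        {in adv_perp x &, forall y w, Bz (adv x y) (adv x w) = Bv y w} &
      Bv x x = - 1 ->
        {in adv_perp x &, forall y w, Bz (adv x y) (adv x w) = - Bv y w}].

End HType.

Section MetricLieAlgebra.
Context (F : fieldType) (n : vectType F) (br : {bilinear n -> n -> n}).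
Context (B : {symmetric n}).

Definition zpart : {vspace n} := center br.
Definition vpart : {vspace n} := orthov B zpart.

(* The bracket v x v -> z; vsproj only retypes, since the bracket of a two-step
   nilpotent Lie algebra takes its values in the center (brvzE). *)
Definition brvz (x y : subvs_of vpart) : subvs_of zpart :=
  vsproj zpart (br (vsval x) (vsval y)).

Fact brvz_bilinear :
  bilinear_for (GRing.Scale.Law.clone _ _ *:%R _)
    (GRing.Scale.Law.clone _ _ *:%R _) brvz.
Proof.
split=> [u0|u] a x y; rewrite /brvz !linearP /=; last by [].
by rewrite linearPl linearP.
Qed.

HB.instance Definition _ :=
  bilinear_isBilinear.Build F _ _ _ _ _ brvz brvz_bilinear.

Lemma brvzE : is_lie_bracket br -> two_step_nilpotent br ->
  forall x y, vsval (brvz x y) = br (vsval x) (vsval y).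
Proof.
move=> [alt _] [nil _] x y; rewrite vsprojK //; apply/centerP => w.
have anti a b : br a b = - br b a.
  apply/eqP; rewrite -addr_eq0; apply/eqP.
  by have := alt (a + b); rewrite linearDl !linearDr /= !alt add0r addr0 addrC.
by rewrite anti nil oppr0.
Qed.

Definition lie_pseudo_H_type : Prop :=
  pseudo_H_type brvz (restr_form B vpart) (restr_form B zpart).

Definition lie_general_H_type : Prop :=
  general_H_type brvz (restr_form B vpart) (restr_form B zpart).

(* v is a complement of z and <.,.>_v is non-degenerate, so that JmapE applies
   to the operators in lie_pseudo_H_type. *)
Lemma vz_direct : nondegenerate (restr_form B zpart) ->
  (vpart :&: zpart = 0)%VS.
Proof. by rewrite restr_form_nondegenerate capvC => /eqP. Qed.

Lemma vz_sum : nondegenerate (restr_form B zpart) ->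
  (vpart + zpart = fullv)%VS.
Proof.
move=> nd; apply/eqP; rewrite eqEsubv subvf; apply/subvP => x _.
pose f (w : subvs_of zpart) : F^o := B x (vsval w).
have f_lin : linear f by move=> a s t; rewrite /f !linearP.
pose L : {linear subvs_of zpart -> F^o} :=
  HB.pack f (GRing.isLinear.Build F _ F^o _ _ f_lin).
have /memv_imgP[y _ fy] : linfun L \in limg (flat (restr_form B zpart)).
  by rewrite flat_surj ?memvf.
rewrite -(subrK (vsval y) x) memv_add ?subvsP //.
apply/mem_orthovP => w wz; rewrite linearBl /=.
have /lfunP/(_ (vsproj zpart w)) := fy.
rewrite flatE lfunE /= /f /restr_form vsprojK // => ->.
by rewrite subrr.
Qed.

Lemma vpart_nondegenerate : nondegenerate B ->
  nondegenerate (restr_form B zpart) -> nondegenerate (restr_form B vpart).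
Proof.
move=> /eqP nd ndz; rewrite restr_form_nondegenerate -subv0 -nd.
apply/subvP => x /memv_capP[/mem_orthovP xv /mem_orthovP xo].
apply/mem_orthovP => y; rewrite -(vz_sum ndz) => /memv_addP[a av [b bz ->]].
by rewrite linearDr /= xo // xv // addr0.
Qed.

End MetricLieAlgebra.

(* Main.v *)
Require Import Defs.
From HB Require Import structures.
From mathcomp Require Import all_boot all_order all_algebra.
From mathcomp Require Import reals ring.

(** Both conditions are read off from one computation.  For x in v the operators
    J_Z satisfy <J_Z x, w> = <Z, [x, w]>, so Z |-> J_Z x is the adjoint of ad_x
    and takes its values in the orthogonal complement of ker ad_x.

    If n is of pseudo H-type and <x, x> = e = +1 or -1, polarising in Z gives
    <Z, [x, J_W x]> = <J_Z x, J_W x> = e <Z, W>, that is, ad_x (J_W x) = e W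
    ([ad_Jmap]).  Hence w |-> e J_(ad_x w) x is a projection along ker ad_x,
    whose image is orthogonal to ker ad_x.  This splits v orthogonally into
    ker ad_x and {J_Z x}; the kernel is therefore non-degenerate, and ad_x is,
    up to the sign e, an isometry from its orthogonal complement onto z.

    Conversely, suppose <x, x> = e and Z = ad_x y with y orthogonal to ker ad_x.
    As J_Z x is orthogonal to ker ad_x too, the (anti-)isometry gives
    <J_Z x, J_Z x> = <ad_x y, ad_x (J_Z x)> = e <y, J_Z x> = e <Z, Z>.
    Rescaling yields the identity of pseudo H-type for every x with <x, x> <> 0.
    Null vectors are not reached by rescaling: there the identity follows from
    the vanishing of a quadratic polynomial on a line through x that meets the
    null cone only at x ([quadratic_identity_on_null_vectors]). *)

Set Implicit Arguments.
Unset Strict Implicit.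
Unset Printing Implicit Defensive.

Import Order.TTheory GRing.Theory Num.Theory.
Local Open Scope ring_scope.

Lemma form_sym (F : fieldType) (V : vectType F) (B : {symmetric V}) x y :
  B x y = B y x.
Proof. by rewrite hermC /= expr0 mul1r. Qed.

Lemma nondegenerate_eq0 (F : fieldType) (V : vectType F) (B : {symmetric V}) x :
  nondegenerate B -> (forall y, B x y = 0) -> x = 0.
Proof.
move=> /eqP nd Bx0; apply/eqP; rewrite -memv0 -nd.
by apply/mem_orthovP => y _; apply: Bx0.
Qed.

Lemma nondegenerate_eq (F : fieldType) (V : vectType F) (B : {symmetric V}) x y :
  nondegenerate B -> (forall w, B w x = B w y) -> x = y.
Proof.
move=> nd Bxy; apply/eqP; rewrite -subr_eq0; apply/eqP.
apply: (nondegenerate_eq0 nd) => w.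
by rewrite form_sym linearBr /= Bxy subrr.
Qed.

(** A null vector x <> 0 has a partner y with <x, y> = 1 and <y, y> = 0, so that
    <x + t y, x + t y> = 2 t.  The difference of the two sides of the conclusion
    is a polynomial of degree at most two in t, which vanishes at 1, -1 and 2,
    hence at 0. *)
Lemma quadratic_identity_on_null_vectors (F : numFieldType) (V : vectType F)
    (B : {symmetric V}) (f : 'End(V)) (c : F) :
  nondegenerate B ->
  (forall x, B x x != 0 -> B (f x) (f x) = c * B x x) ->
  forall x, B (f x) (f x) = c * B x x.
Proof.
move=> nd H x; have [Bx0|] := eqVneq (B x x) 0; last exact: H.
have [->|x0] := eqVneq x 0; first by rewrite !linear0 /= mulr0.
have [y Bxy Byy] : exists2 y, B x y = 1 & B y y = 0.
  have [y0 By0] : exists y0, B x y0 != 0.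
    have /allPn[u _ Bu] : ~~ all (fun u => B x u == 0) (vbasis {:V}).
      apply: contra x0 => /allP Bx_all; apply/eqP.
      apply: (nondegenerate_eq0 nd) => y.
      rewrite (coord_vbasis (memvf y)) linear_sumr big1 // => i _.
      rewrite linearZr_LR /=.
      have /Bx_all/eqP -> : (vbasis {:V})`_i \in vbasis {:V}.
        by rewrite mem_nth // size_tuple.
      by rewrite mulr0.
    by exists u.
  have [y1 Bxy1] : exists y1, B x y1 = 1.
    by exists ((B x y0)^-1 *: y0); rewrite linearZr_LR /= mulVf.
  (* subtracting a multiple of x makes y1 null without changing <x, y1> *)
  exists (y1 - (B y1 y1 / 2) *: x).
    by rewrite linearBr linearZr_LR /= Bx0 mulr0 subr0.
  rewrite linearBl !linearBr !linearZl_LR !linearZr_LR /= Bx0 (form_sym B y1 x).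
  by rewrite Bxy1; field.
have quad t : t != 0 ->
    B (f x) (f x) + t * (B (f x) (f y) *+ 2) + t ^+ 2 * B (f y) (f y)
    = c * (t *+ 2).
  move=> t0; have := H (x + t *: y).
  have -> : f (x + t *: y) = f x + t *: f y by rewrite linearD linearZ.
  rewrite !linearDl !linearDr !linearZl_LR !linearZr_LR /=.
  rewrite Bx0 Byy (form_sym B y x) Bxy (form_sym B (f y) (f x)).
  rewrite !mulr0 !addr0 add0r mulr1 -mulr2n => quadt.
  rewrite -quadt ?mulrn_eq0 //; ring.
have n1 : (1 : F) != 0 := oner_neq0 _.
have n2 : (-1 : F) != 0 by rewrite oppr_eq0.
have n3 : (2 : F) != 0 by rewrite pnatr_eq0.
have := (quad 1 n1, quad (-1) n2, quad 2 n3).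
set a := B (f x) (f x); set b := B (f x) (f y); set d := B (f y) (f y).
case=> [[e1 e2] e3]; rewrite Bx0 mulr0.
(* Lagrange interpolation at the nodes 1, -1, 2, evaluated at 0 *)
have -> : a = (a + 1 * (b *+ 2) + 1 ^+ 2 * d)
   + (a + -1 * (b *+ 2) + (-1) ^+ 2 * d) / 3
   - (a + 2 * (b *+ 2) + 2 ^+ 2 * d) / 3 by field.
by rewrite e1 e2 e3; field.
Qed.

Section HType.
Context (F : fieldType) (v z : vectType F) (br : {bilinear v -> v -> z}).
Context (Bv : {symmetric v}) (Bz : {symmetric z}).
Hypothesis (Bv_nd : nondegenerate Bv).

Let J := Jmap br Bv Bz.
Let JE Z x w : Bv (J Z x) w = Bz Z (br x w) := JmapE br Bz Bv_nd Z x w.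

Lemma mem_ker_adv x w : (w \in lker (adv br x)) = (br x w == 0).
Proof. by rewrite memv_ker lfunE. Qed.

(** Pairing J_Z x with w amounts to pairing Z with [x, w], which is zero on the
    kernel of ad_x. *)
Lemma Jmap_adv_perp x Z : J Z x \in adv_perp br Bv x.
Proof.
apply/mem_orthovP => w; rewrite mem_ker_adv => /eqP xw0.
by rewrite /= JE xw0 linear0r.
Qed.

Lemma JmapD Z W x : J (Z + W) x = J Z x + J W x.
Proof.
apply: (nondegenerate_eq Bv_nd) => w.
by rewrite linearDr /= !(form_sym Bv w) !JE linearDl.
Qed.

Lemma pseudo_H_type_polar : (2 : F) != 0 -> pseudo_H_type br Bv Bz ->
  forall Z W x, Bv (J Z x) (J W x) = Bz Z W * Bv x x.
Proof.
move=> two0 H Z W x; apply: (mulfI two0).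
have := H (Z + W) x; rewrite -/J JmapD !linearDl !linearDr /= -/J !H.
rewrite (form_sym Bv (J W x)) (form_sym Bz W) => e.
have -> : 2 * Bv (J Z x) (J W x) =
  (Bz Z Z * Bv x x + Bv (J Z x) (J W x)
   + (Bv (J Z x) (J W x) + Bz W W * Bv x x))
  - Bz Z Z * Bv x x - Bz W W * Bv x x by ring.
by rewrite e; ring.
Qed.

(** The adjoint Z |-> J_Z x of ad_x is thus, up to the factor <x, x>, a right
    inverse of ad_x. *)
Lemma ad_Jmap : (2 : F) != 0 -> nondegenerate Bz -> pseudo_H_type br Bv Bz ->
  forall x W, br x (J W x) = Bv x x *: W.
Proof.
move=> two0 Bz_nd H x W; apply: (nondegenerate_eq Bz_nd) => Z.
by rewrite -JE pseudo_H_type_polar // linearZr_LR /= mulrC.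
Qed.

(** The decomposition v = ker ad_x + {J_Z x} is orthogonal, so a vector of the
    kernel that is orthogonal to the kernel is orthogonal to all of v; this gives
    the non-degeneracy and identifies the orthogonal complement of ker ad_x with
    {J_Z x}, where the remaining properties can be computed. *)
Lemma pseudo_general_H_type : (2 : F) != 0 -> nondegenerate Bz ->
  pseudo_H_type br Bv Bz -> general_H_type br Bv Bz.
Proof.
move=> two0 Bz_nd H x; set e := Bv x x => e1.
have ee : e * e = 1 by case: e1 => ->; rewrite ?mulrNN mulr1.
have adJ W : br x (J W x) = e *: W by apply: ad_Jmap.
(* k is the orthogonal projection onto ker ad_x, along {J_Z x} *)
pose k w := w - e *: J (br x w) x.
have k_ker w : k w \in lker (adv br x).
  by rewrite mem_ker_adv linearBr linearZr_LR /= adJ scalerA ee scale1r subrr.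
have ker_perp0 u : u \in lker (adv br x) -> u \in adv_perp br Bv x -> u = 0.
  move=> u_ker /mem_orthovP u_perp; apply: (nondegenerate_eq0 Bv_nd) => w.
  have -> : w = k w + e *: J (br x w) x by rewrite subrK.
  rewrite linearDr linearZr_LR /= u_perp // form_sym.
  by have /mem_orthovP -> := Jmap_adv_perp x (br x w); rewrite // mulr0 addr0.
have perpE w : w \in adv_perp br Bv x -> w = e *: J (br x w) x.
  move=> w_perp; apply/eqP; rewrite -subr_eq0; apply/eqP.
  apply: ker_perp0; first exact: k_ker.
  by rewrite memvB // memvZ // Jmap_adv_perp.
have ad_scaled : {in adv_perp br Bv x &, forall y w,
    Bz (adv br x y) (adv br x w) = e * Bv y w}.
  move=> y w y_perp _; rewrite !lfunE /= [in Bv y w](perpE y y_perp).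
  by rewrite linearZl_LR /= JE mulrA ee mul1r.
split.
- rewrite restr_form_nondegenerate -subv0; apply/subvP => u /memv_capP[u1 u2].
  by rewrite (ker_perp0 u) ?mem0v.
- apply/eqP; rewrite eqEsubv subvf; apply/subvP => Z _; apply/memv_imgP.
  exists (e *: J Z x); first by rewrite memvZ // Jmap_adv_perp.
  by rewrite lfunE /= linearZr_LR /= adJ scalerA ee scale1r.
- by move=> ex y w y_perp w_perp; rewrite ad_scaled // ex mul1r.
- by move=> ex y w y_perp w_perp; rewrite ad_scaled // ex mulN1r.
Qed.

(** Writing Z as ad_x y turns <Z, [x, J_Z x]> = <J_Z x, J_Z x> into an inner
    product of two values of ad_x on the complement of its kernel, to which the
    (anti-)isometry applies. *)
Lemma general_H_type_unit : general_H_type br Bv Bz ->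
  forall Z x, Bv x x = 1 \/ Bv x x = -1 ->
  Bv (J Z x) (J Z x) = Bz Z Z * Bv x x.
Proof.
move=> H Z x e1; have [_ surj iso aiso] := H x e1.
have /memv_imgP[y y_perp Zy] : Z \in (adv br x @: adv_perp br Bv x)%VS.
  by rewrite surj memvf.
have ad_scaled : {in adv_perp br Bv x &, forall y w,
    Bz (adv br x y) (adv br x w) = Bv x x * Bv y w}.
  move=> u w u_perp w_perp; case: e1 => ex.
    by rewrite iso // ex mul1r.
  by rewrite aiso // ex mulN1r.
have xy : br x y = Z by rewrite Zy lfunE.
have := ad_scaled y (J Z x) y_perp (Jmap_adv_perp x Z).
by rewrite -Zy lfunE /= -JE form_sym => ->; rewrite form_sym JE xy mulrC.
Qed.

End HType.

(** Square roots in R turn any non-null vector into a multiple of one with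
    <x, x> = +1 or -1. *)
Lemma general_pseudo_H_type (R : rcfType) (v z : vectType R)
    (br : {bilinear v -> v -> z}) (Bv : {symmetric v}) (Bz : {symmetric z}) :
  nondegenerate Bv -> general_H_type br Bv Bz -> pseudo_H_type br Bv Bz.
Proof.
move=> Bv_nd H Z; apply: quadratic_identity_on_null_vectors => // x xx0.
pose s := Num.sqrt `|Bv x x|.
have ss : s * s = `|Bv x x| by rewrite -expr2 sqr_sqrtr.
have s0 : s != 0 by rewrite sqrtr_eq0 -ltNge normr_gt0.
pose u := s^-1 *: x.
have xE : x = s *: u by rewrite scalerA mulfV // scale1r.
have sq : Bv x x = s * s * Bv u u.
  by rewrite [in LHS]xE linearZl_LR linearZr_LR /= mulrA.
have u1 : Bv u u = 1 \/ Bv u u = -1.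
  have ss0 : s * s != 0 by rewrite mulf_neq0.
  have [le0|lt0] := lerP 0 (Bv x x).
    left; apply: (mulfI ss0).
    by rewrite -sq mulr1 ss ger0_norm.
  right; apply: (mulfI ss0).
  by rewrite -sq mulrN1 ss ltr0_norm // opprK.
have unit_id := general_H_type_unit Bv_nd H Z u1.
rewrite sq xE linearZ /= linearZl_LR linearZr_LR /= unit_id; ring.
Qed.

Theorem theorem7p4 (R : realType) (n : vectType R)
    (br : {bilinear n -> n -> n}) (B : {symmetric n})
    (br_lie : is_lie_bracket br) (br_nil : two_step_nilpotent br)
    (B_nd : nondegenerate B)
    (Bz_nd : nondegenerate (restr_form B (center br))) :
  lie_pseudo_H_type br B <-> lie_general_H_type br B.
Proof.
have Bv_nd : nondegenerate (restr_form B (vpart br B)).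
  exact: vpart_nondegenerate.
split.
  by apply: pseudo_general_H_type => //; rewrite pnatr_eq0.
exact: general_pseudo_H_type.
Qed.
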